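(* Let $n,N$ be positive integers and let $A_1,\ldots,A_N,B_1,\ldots,B_N\in\mathbb{R}^{n\times n}$ be (entrywise) nonnegative matrices. Let $M_1=\{(A_s+B_r)^T : 1\le s,r\le N\}$ and $M_2=\{A_s+B_s : 1\le s\le N\}$, and let $$\rho_1=\max\{\rho(A)\mid A\in\mathcal{R}(M_1)\},\qquad \rho_2=\max\{\rho(A)\mid A\in\mathcal{R}(M_2)\}.$$ Then there exist real numbers $\mu>0$, $\lambda>0$ and vectors $d\gg 0$, $\theta\gg 0$ in $\mathbb{R}^n$ satisfying $$(A_s+B_r)^Td\le\mu d\quad (s,r=1,\ldots,N),\qquad (A_s+B_s)\theta\le\lambda\theta\quad (s=1,\ldots,N),\qquad \lambda\mu<1$$ if and only if $\rho_1\rho_2<1$.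
   Context: Vector inequalities are componentwise: $v\le w$ means $v_i\le w_i$ for all $i$, and $v\gg 0$ means $v_i>0$ for all $i$. $\rho(A)$ denotes the spectral radius of $A$. For a finite set $M$ of $n\times n$ matrices, the row selection set $\mathcal{R}(M)$ consists of all $n\times n$ matrices such that, for each $i=1,\ldots,n$, the $i$-th row is the $i$-th row of some matrix in $M$ (the matrix in $M$ may depend on $i$). *)

(* Defs.v *)
From HB Require Import structures.
From mathcomp Require Import all_boot all_order all_algebra.
From mathcomp Require Import boolp classical_sets cardinality reals.
From mathcomp Require Import complex.

Set Implicit Arguments.
Unset Strict Implicit.
Unset Printing Implicit Defensive.

Import Order.TTheory GRing.Theory Num.Theory.

Local Open Scope classical_set_scope.
Local Open Scope ring_scope.

Definition mx_le (R : realType) (m n : nat) (A B : 'M[R]_(m, n)) : Prop :=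
  forall i j, A i j <= B i j.

Definition mx_gt0 (R : realType) (m n : nat) (A : 'M[R]_(m, n)) : Prop :=
  forall i j, 0 < A i j.

(* [eigenvalue] is stated for left (row) eigenvectors; a square matrix has the
   same eigenvalues on both sides. *)
Definition complex_spectrum (R : realType) (n : nat) (A : 'M[R]_n) : set R[i] :=
  [set z | eigenvalue (map_mx (real_complex R) A) z].

(* The supremum is a maximum for [0 < n]: see [spectral_radius_max]. *)
Definition spectral_radius (R : realType) (n : nat) (A : 'M[R]_n) : R :=
  sup [set ComplexField.Normc.normc z | z in complex_spectrum A].

Definition row_selection (R : realType) (n : nat) (M : set 'M[R]_n) :
    set 'M[R]_n :=
  [set C | forall i, exists2 D, M D & row i C = row i D].

(* The supremum is a maximum for finite nonempty [M]: see
   [max_selection_radius_max]. *)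
Definition max_selection_radius (R : realType) (n : nat) (M : set 'M[R]_n) : R :=
  sup [set spectral_radius C | C in row_selection M].

Definition is_max (R : realType) (E : set R) (x : R) : Prop :=
  E x /\ ubound E x.

Lemma finite_sup_max (R : realType) (E : set R) :
  finite_set E -> E !=set0 -> is_max E (sup E).
Proof.
move=> /finite_seqP[s ->] [x0 /= x0s].
suff [x [xs hx]] : exists x, x \in s /\ forall y, y \in s -> y <= x.
  have ub : ubound [set` s] x by move=> y /= /hx.
  have -> : sup [set` s] = x.
    apply/eqP; rewrite eq_le; apply/andP; split.
      by apply: ge_sup => //; exists x0.
    by apply: ub_le_sup => //; exists x.
  by split.
elim: s x0 x0s => // a s IH _ _.
have [->|] := eqVneq s [::].
  by exists a; rewrite inE eqxx; split=> // y; rewrite inE => /eqP->.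
case: s IH => // b s IH _.
have [|x [xs hx]] := IH b; first by rewrite inE eqxx.
have [ax|xa] := leP a x.
  exists x; split=> [|y]; first by rewrite inE xs orbT.
  by rewrite inE => /predU1P[->//|/hx].
exists a; split=> [|y]; first by rewrite inE eqxx.
by rewrite inE => /predU1P[->//|/hx /le_trans]; apply; exact: ltW.
Qed.

Lemma spectral_radius_max (R : realType) (n : nat) (A : 'M[R]_n) : (0 < n)%N ->
  is_max [set ComplexField.Normc.normc z | z in complex_spectrum A]
         (spectral_radius A).
Proof.
move=> n0; apply: finite_sup_max.
  apply: finite_image.
  set p := char_poly (map_mx (real_complex R) A).
  have p0 : p != 0 by rewrite monic_neq0 // char_poly_monic.
  have [r pr] := closed_field_poly_normal p.
  apply: (@sub_finite_set _ _ [set` r]); last exact: finite_seq.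
  move=> z /=; rewrite /complex_spectrum /= eigenvalue_root_char -/p pr.
  by rewrite rootZ ?lead_coef_eq0 // root_prod_XsubC.
have [|z hz] := @closed_rootP R[i] (char_poly (map_mx (real_complex R) A)) _.
  by rewrite size_char_poly; case: n n0 A.
exists (ComplexField.Normc.normc z), z => //=.
by rewrite /complex_spectrum /= eigenvalue_root_char.
Qed.

Lemma max_selection_radius_max (R : realType) (n : nat) (M : set 'M[R]_n) :
  finite_set M -> M !=set0 ->
  is_max [set spectral_radius C | C in row_selection M]
         (max_selection_radius M).
Proof.
move=> /finite_seqP[s ->] [D0 D0s]; apply: finite_sup_max; last first.
  by exists (spectral_radius D0), D0 => //= i; exists D0.
apply: finite_image.
pose F (f : {ffun 'I_n -> 'I_(size s)}) : 'M[R]_n :=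
  \matrix_(i, j) nth 0 s (f i) i j.
apply: (@sub_finite_set _ _ (range F)); last exact/finite_image/finite_finset.
move=> C hC.
have hC' i : exists k : 'I_(size s), row i C = row i (nth 0 s k).
  have [D /= Ds ->] := hC i.
  have ltk : (index D s < size s)%N by rewrite index_mem.
  by exists (Ordinal ltk); rewrite /= nth_index.
have [f hf] := choice hC'.
exists [ffun i => f i] => //; apply/matrixP => i j.
by rewrite !mxE ffunE; move/rowP: (hf i) => /(_ j); rewrite !mxE.
Qed.

(* Main.v *)
Require Import Defs.
From HB Require Import structures.
From mathcomp Require Import all_boot all_order all_algebra.
From mathcomp Require Import boolp classical_sets cardinality reals.
From mathcomp Require Import complex.
From mathcomp Require Import ring lra.

Set Implicit Arguments.
Unset Strict Implicit.
Unset Printing Implicit Defensive.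

Import Order.TTheory GRing.Theory Num.Theory.

Local Open Scope classical_set_scope.
Local Open Scope ring_scope.

(** Both directions rest on one principle for a finite family of nonnegative
    matrices whose rows may be chosen independently: bounding the largest
    spectral radius over row selections by [mu] amounts, up to strictness, to
    finding one positive vector [d] with [C d <= mu d] for every member [C].

    Such a [d] serves every row selection at once, since the inequality is
    checked row by row, and a positive subinvariant vector of rate [mu] bounds
    the spectral radius by [mu] ([max_selection_radius_le]).

    Conversely, let [mu] exceed every spectral radius.  Each single selection
    [C] then has a positive [x] with [C x < mu x]
    ([exists_strictly_subinvariant]), which makes [(mu - C)^-1] nonnegative
    ([resolvent_nonneg]).  This is all that is used of Perron-Frobenius theory,
    and it is derived from an infimum of rates instead of limits of powers or
    resolvents.  Inverse positivity allows a policy-iteration argument: the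
    selection maximising the sum of the entries of [(mu - C)^-1 1] yields a
    vector that works for the whole family ([common_subinvariant]).

    Applied to both families, this gives [rho1 <= mu] and [rho2 <= lambda] in
    one direction; in the other, [rho1 * rho2 < 1] leaves room for rates
    [mu > rho1] and [lambda > rho2] whose product is still below 1. *)

(** * Spectral radius and positive subinvariant vectors *)

Local Notation normc := ComplexField.Normc.normc.

Lemma normc_real (R : realType) (x : R) : normc (real_complex R x) = `|x|.
Proof. by rewrite /normc /= expr0n addr0 sqrtr_sqr. Qed.

Lemma normc_ge0 (R : realType) (z : R[i]) : 0 <= normc z.
Proof. by case: z => a b; exact: sqrtr_ge0. Qed.

Lemma normc_sum (R : realType) (I : finType) (F : I -> R[i]) :
  normc (\sum_i F i) <= \sum_i normc (F i).
Proof.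
elim/big_ind2: _ => [|x a y b xa yb|//].
  by rewrite ComplexField.Normc.normc0.
exact: le_trans (le_normcD _ _) (lerD xa yb).
Qed.

Lemma spectral_radius_ge_real (R : realType) (n : nat) (C : 'M[R]_n) (s : R)
    (v : 'rV[R]_n) : (0 < n)%N -> v *m C = s *: v -> v != 0 ->
  s <= spectral_radius C.
Proof.
move=> n_gt0 vC v0; have [_ ub] := spectral_radius_max C n_gt0.
apply: le_trans (ler_norm s) _; rewrite -normc_real; apply: ub.
exists (real_complex R s) => //=; apply/eigenvalueP.
exists (map_mx (real_complex R) v); last by rewrite map_mx_eq0.
by rewrite -map_mxM vC map_mxZ.
Qed.

Lemma spectral_radius_ge0 (R : realType) (n : nat) (C : 'M[R]_n) :
  (0 < n)%N -> 0 <= spectral_radius C.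
Proof.
move=> n_gt0; have [[z _ <-] _] := spectral_radius_max C n_gt0.
exact: normc_ge0.
Qed.

(** Pairing the moduli of a left eigenvector [v] for [z] with [d] gives
    [|z| (|v| d) <= |v| (C d) <= mu (|v| d)], and [|v| d > 0]. *)
Lemma spectral_radius_le (R : realType) (n : nat) (C : 'M[R]_n) (mu : R)
    (d : 'cV[R]_n) : (0 < n)%N -> mx_le 0 C -> mx_gt0 d ->
  mx_le (C *m d) (mu *: d) -> spectral_radius C <= mu.
Proof.
move=> n_gt0 C_ge0 d_gt0 Cd.
have [[z /eigenvalueP[v vC v0] <-] _] := spectral_radius_max C n_gt0.
pose w i := normc (v 0 i).
have wj j : normc z * w j <= \sum_i w i * C i j.
  rewrite /w -ComplexField.Normc.normcM.
  move/rowP: vC => /(_ j); rewrite !mxE => <-.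
  apply: le_trans (normc_sum _) _; apply: ler_sum => i _.
  rewrite ComplexField.Normc.normcM mxE normc_real ger0_norm //.
  by have := C_ge0 i j; rewrite mxE.
have wd_gt0 : 0 < \sum_i w i * d i 0.
  have /rV0Pn[i vi] := v0.
  rewrite (bigD1 i) //= ltr_pwDl //.
    rewrite mulr_gt0 // lt_neqAle normc_ge0 andbT eq_sym.
    by apply: contra vi => /eqP/ComplexField.Normc.eq0_normc ->.
  by apply: sumr_ge0 => k _; rewrite mulr_ge0 ?normc_ge0 // ltW.
rewrite -(ler_pM2r wd_gt0) !mulr_sumr.
have step1 : \sum_i normc z * (w i * d i 0) <=
    \sum_j (\sum_i w i * C i j) * d j 0.
  by apply: ler_sum => j _; rewrite mulrA ler_wpM2r // ltW.
apply: le_trans step1 _.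
under eq_bigr do rewrite mulr_suml.
rewrite exchange_big /=; apply: ler_sum => i _.
have := Cd i 0; rewrite !mxE => Cdi.
under eq_bigr do rewrite -mulrA.
by rewrite -mulr_sumr mulrCA ler_wpM2l ?normc_ge0.
Qed.

Definition strictly_subinvariant (R : realType) (n : nat) (C : 'M[R]_n) (t : R)
    (x : 'cV[R]_n) : Prop :=
  mx_gt0 x /\ forall i, (C *m x) i 0 < t * x i 0.

(** Inverse positivity of [t - C].  Were [y] negative somewhere, let [i]
    minimise [y i / x i], with minimum [m < 0]; then [y - m x] is nonnegative
    and vanishes at [i], so [(t - C) (y - m x)] is nonpositive at [i], whereas
    [(t - C) y >= 0] and [- m (t - C) x > 0]. *)
Lemma resolvent_nonneg (R : realType) (n : nat) (C : 'M[R]_n) (t : R)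
    (x y : 'cV[R]_n) : mx_le 0 C -> strictly_subinvariant C t x ->
  (forall i, (C *m y) i 0 <= t * y i 0) -> forall i, 0 <= y i 0.
Proof.
move=> C_ge0 [x_gt0 Cx] Cy i0.
pose m := y i0 0 / x i0 0.
case: (@arg_minP _ _ _ i0 xpredT (fun i => y i 0 / x i 0) isT) => i _ imin.
set r := y i 0 / x i 0 in imin.
have [r_ge0|r_lt0] := leP 0 r.
  by have := le_trans r_ge0 (imin i0 isT); rewrite ler_pdivlMr // mul0r.
have ry k : r * x k 0 <= y k 0 by rewrite -ler_pdivlMr // imin.
have ryi : r * x i 0 = y i 0 by rewrite mulfVK ?gt_eqF.
have : r * (C *m x) i 0 <= (C *m y) i 0.
  rewrite !mxE mulr_sumr; apply: ler_sum => k _; rewrite mulrCA.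
  by have := C_ge0 i k; rewrite mxE => Cik; rewrite ler_wpM2l.
have := Cy i; rewrite -ryi mulrCA => h1 h2.
have := le_trans h2 h1.
by rewrite ler_nM2l // leNgt Cx.
Qed.

Lemma resolvent_solvable (R : realType) (n : nat) (C : 'M[R]_n) (t : R) :
  (forall v : 'rV[R]_n, v *m C = t *: v -> v = 0) ->
  forall b : 'cV[R]_n, exists y : 'cV[R]_n, t *: y = C *m y + b.
Proof.
move=> ker0 b.
have U : t%:M - C \in unitmx.
  rewrite unitmxE unitfE; apply/negP => /det0P[v v0 /eqP].
  rewrite mulmxBr mul_mx_scalar subr_eq0 => /eqP/esym/ker0 v_eq0.
  by rewrite v_eq0 eqxx in v0.
exists (invmx (t%:M - C) *m b).
have := mulKVmx U b; rewrite mulmxBl mul_scalar_mx => /eqP.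
by rewrite subr_eq [b + _]addrC => /eqP.
Qed.

(** The right-hand side being positive makes a nonnegative solution positive. *)
Lemma resolvent_pos (R : realType) (n : nat) (C : 'M[R]_n) (t : R)
    (y : 'cV[R]_n) : mx_le 0 C -> t *: y = C *m y + const_mx 1 ->
  (forall i, 0 <= y i 0) -> mx_gt0 y.
Proof.
move=> C_ge0 yE y_ge0 i j; rewrite (ord1 j).
rewrite lt_neqAle y_ge0 andbT eq_sym; apply/eqP => yi0.
move/colP: yE => /(_ i); rewrite !mxE yi0 mulr0 => /esym/eqP.
rewrite gt_eqF // ltr_wpDl //.
apply: sumr_ge0 => k _; have := C_ge0 i k; rewrite mxE => Cik.
by rewrite mulr_ge0.
Qed.

(** The infimum [s] of the rates [t] admitting a strictly subinvariant vector
    is an eigenvalue, hence [s <= spectral_radius C < mu].  Otherwise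
    [s y = C y + 1] has a solution [y]; for a rate [t] just above [s],
    [(t - C) y = 1 + (t - s) y] is still nonnegative, so [y >= 0] and then
    [y > 0]; but then [y] is strictly subinvariant for a rate below [s]. *)
Lemma exists_strictly_subinvariant (R : realType) (n : nat) (C : 'M[R]_n)
    (mu : R) : (0 < n)%N -> mx_le 0 C -> spectral_radius C < mu ->
  exists x, strictly_subinvariant C mu x.
Proof.
move=> n_gt0 C_ge0 rho_lt.
have C_ge i j : 0 <= C i j by have := C_ge0 i j; rewrite mxE.
pose S : set R := [set t | exists x, strictly_subinvariant C t x].
have S0 : S !=set0.
  exists (1 + \sum_i \sum_j C i j), (const_mx 1); split=> [i j|i].
    by rewrite mxE.
  rewrite !mxE mulr1 [in ltRHS](bigD1 i) //= addrCA.
  under eq_bigr do rewrite mxE mulr1.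
  rewrite ltrDl ltr_pwDl // sumr_ge0 // => k _.
  by rewrite sumr_ge0.
have lb0 : lbound S 0.
  move=> t [x [x_gt0 Cx]]; pose i := Ordinal n_gt0.
  rewrite -(ler_pM2r (x_gt0 i 0)) mul0r; apply: le_trans (ltW (Cx i)).
  by rewrite mxE sumr_ge0 // => k _; rewrite mulr_ge0 // ltW.
have hS : has_inf S by split => //; exists 0.
set s := inf S.
suff s_le : s <= spectral_radius C.
  have [|t [x [x_gt0 Cx]] tlt] := @inf_adherent _ S (mu - s) _ hS.
    by rewrite subr_gt0 (le_lt_trans s_le).
  exists x; split=> // i; apply: lt_le_trans (Cx i) _.
  by rewrite ler_wpM2r ?ltW //; move: tlt; rewrite -/s addrC subrK.
rewrite leNgt; apply/negP => s_gt.
have ker0 (v : 'rV[R]_n) : v *m C = s *: v -> v = 0.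
  move=> vC; apply/eqP; apply: contraLR s_gt => v0.
  by rewrite -leNgt; apply: spectral_radius_ge_real v0.
have [y yE] := resolvent_solvable ker0 (const_mx 1).
have yi i : s * y i 0 = (C *m y) i 0 + 1.
  by move/colP: yE => /(_ i); rewrite !mxE.
(* Small enough for [1 + (t - s) y] and [1 - e y] to stay positive. *)
pose e := (1 + \sum_i `|y i 0|)^-1.
have D_gt0 : 0 < 1 + \sum_i `|y i 0| by rewrite ltr_pwDl // sumr_ge0.
have e_gt0 : 0 < e by rewrite invr_gt0.
have ey i : e * `|y i 0| < 1.
  rewrite mulrC ltr_pdivrMr // mul1r (bigD1 i) //= addrCA ltrDl ltr_pwDl //.
  exact: sumr_ge0.
have y_ge0 : forall i, 0 <= y i 0.
  have [t [x tx] tlt] := inf_adherent e_gt0 hS.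
  have st : s <= t by apply: ge_inf; [exists 0 | exists x].
  apply: resolvent_nonneg C_ge0 tx _ => i.
  have h1 : (t - s) * `|y i 0| <= e * `|y i 0|.
    by rewrite ler_wpM2r // lerBlDl ltW.
  have h2 : (t - s) * - y i 0 <= (t - s) * `|y i 0|.
    by rewrite ler_wpM2l ?subr_ge0 // -normrN ler_norm.
  by have := yi i; have := ey i; lra.
have y_gt0 := resolvent_pos C_ge0 yE y_ge0.
have : s <= s - e.
  apply: ge_inf; first by exists 0.
  exists y; split=> // i; rewrite mulrBl yi.
  by have := ey i; rewrite ger0_norm //; lra.
by rewrite leNgt ltrBlDr ltrDl e_gt0.
Qed.

(** * Families with independent row choices *)

(** Indexing row selections by choice functions makes them range over a finite
    type when [K] is finite, so that a maximising one can be picked. *)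
Definition row_choice (R : realType) (n : nat) (K : Type) (F : K -> 'M[R]_n)
    (f : 'I_n -> K) : 'M[R]_n := \matrix_(i, j) F (f i) i j.

Lemma row_choice_selection (R : realType) (n : nat) (K : Type)
    (F : K -> 'M[R]_n) (f : 'I_n -> K) :
  row_selection (range F) (row_choice F f).
Proof.
by move=> i; exists (F (f i)); [exists (f i) | apply/rowP => j; rewrite !mxE].
Qed.

Lemma row_choice_mul (R : realType) (n : nat) (K : Type) (F : K -> 'M[R]_n)
    (f : 'I_n -> K) (x : 'cV[R]_n) i :
  (row_choice F f *m x) i 0 = (F (f i) *m x) i 0.
Proof. by rewrite !mxE; under eq_bigr do rewrite mxE. Qed.

Lemma max_selection_radius_range (R : realType) (n : nat) (K : finType)
    (F : K -> 'M[R]_n) : (0 < #|K|)%N ->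
  is_max [set spectral_radius C | C in row_selection (range F)]
         (max_selection_radius (range F)).
Proof.
case/card_gt0P => k _; apply: max_selection_radius_max.
  exact/finite_image/finite_finset.
by exists (F k), k.
Qed.

Lemma max_selection_radius_ge0 (R : realType) (n : nat) (K : finType)
    (F : K -> 'M[R]_n) : (0 < n)%N -> (0 < #|K|)%N ->
  0 <= max_selection_radius (range F).
Proof.
move=> n_gt0 /max_selection_radius_range -/(_ _ _ F)[[C _ <-] _].
exact: spectral_radius_ge0.
Qed.

Lemma max_selection_radius_le (R : realType) (n : nat) (K : finType)
    (F : K -> 'M[R]_n) (mu : R) (d : 'cV[R]_n) : (0 < n)%N -> (0 < #|K|)%N ->
    (forall k, mx_le 0 (F k)) -> mx_gt0 d ->
    (forall k, mx_le (F k *m d) (mu *: d)) ->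
  max_selection_radius (range F) <= mu.
Proof.
move=> n_gt0 /max_selection_radius_range -/(_ _ _ F)[[C CF <-] _].
move=> F_ge0 d_gt0 Fd.
apply: (spectral_radius_le (d := d)) => // i j.
  have [_ [k _ <-] /rowP/(_ j)] := CF i.
  by rewrite !mxE => ->; have := F_ge0 k i j; rewrite mxE.
have [_ [k _ <-] Ci] := CF i; have := Fd k i j; rewrite !mxE.
apply: le_trans; apply: ler_sum => l _.
by move/rowP: Ci => /(_ l); rewrite !mxE => ->.
Qed.

(** Each choice [f] with matrix [C_f] has a vector [d_f > 0] with
    [(mu - C_f) d_f = 1]; take [f] maximising the sum of the entries of [d_f].
    If [F k d_f <= mu d_f] failed in row [i], redefining [f i] as [k] would give
    a choice [g] with [(mu - C_g) d_f <= 1 = (mu - C_g) d_g], strictly at [i].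
    Inverse positivity then gives [d_f <= d_g], and [d_f <> d_g], against
    maximality. *)
Lemma common_subinvariant (R : realType) (n : nat) (K : finType)
    (F : K -> 'M[R]_n) (mu : R) : (0 < n)%N -> (0 < #|K|)%N ->
    (forall k, mx_le 0 (F k)) -> max_selection_radius (range F) < mu ->
  exists2 d : 'cV[R]_n, mx_gt0 d & forall k, mx_le (F k *m d) (mu *: d).
Proof.
move=> n_gt0 K_gt0 F_ge0 rho_lt.
have [_ rho_ub] := max_selection_radius_range F K_gt0.
have Cf_ge0 (f : {ffun 'I_n -> K}) : mx_le 0 (row_choice F f).
  by move=> i j; rewrite [leRHS]mxE; exact: F_ge0.
have /choice[x xP] (f : {ffun 'I_n -> K}) :
    exists x, strictly_subinvariant (row_choice F f) mu x.
  apply: exists_strictly_subinvariant => //; apply: le_lt_trans rho_lt.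
  by apply: rho_ub; exists (row_choice F f) => //; exact: row_choice_selection.
have /choice[d dP] (f : {ffun 'I_n -> K}) : exists d : 'cV[R]_n,
    mu *: d = row_choice F f *m d + const_mx 1.
  apply: resolvent_solvable => v vC; apply/eqP/negPn/negP => v0.
  have := spectral_radius_ge_real n_gt0 vC v0; apply/negP; rewrite -ltNge.
  apply: le_lt_trans rho_lt; apply: rho_ub.
  by exists (row_choice F f) => //; exact: row_choice_selection.
have dE f i : mu * d f i 0 = (row_choice F f *m d f) i 0 + 1.
  by move/colP: (dP f) => /(_ i); rewrite !mxE.
have d_gt0 f : mx_gt0 (d f).
  apply: (resolvent_pos (Cf_ge0 f) (dP f)).
  apply: resolvent_nonneg (Cf_ge0 f) (xP f) _ => i.
  by rewrite dE lerDl.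
have [k0 _] := card_gt0P K_gt0.
pose total f := \sum_i d f i 0.
case: (@arg_maxP _ _ _ [ffun=> k0] xpredT total isT) => f _ fmax.
exists (d f) => // k i j; rewrite (ord1 j) [leRHS]mxE leNgt; apply/negP => lt_i.
pose g := [ffun l => if l == i then k else f l] : {ffun 'I_n -> K}.
have gE l : (row_choice F g *m d f) l 0 =
    if l == i then (F k *m d f) i 0 else (row_choice F f *m d f) l 0.
  by rewrite !row_choice_mul ffunE; case: eqP => // ->.
have dfg : forall l, 0 <= (d g - d f) l 0.
  apply: resolvent_nonneg (Cf_ge0 g) (xP g) _ => l.
  rewrite mulmxBr [leLHS]mxE [X in _ + X <= _]mxE gE [X in _ * X]mxE.
  rewrite [X in _ * (_ + X)]mxE mulrBr dE.
  by case: eqP => [->|_]; [|rewrite dE]; lra.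
have eq_gf l : d g l 0 = d f l 0.
  have sum0 : \sum_l (d g - d f) l 0 == 0.
    rewrite eq_le sumr_ge0 // andbT.
    under eq_bigr do rewrite !mxE.
    by rewrite sumrB subr_le0; exact: (fmax g isT).
  have := sum0; rewrite psumr_eq0 // => /allP/(_ l (mem_index_enum l)) /=.
  by rewrite !mxE subr_eq0 => /eqP.
have dgf : d g = d f by apply/colP.
by have := dE g i; rewrite dgf gE eqxx; move: lt_i; lra.
Qed.

(** * Product of two selection radii *)

Theorem proposition4p3 (R : realType) (n N : nat) (n_gt0 : (0 < n)%N)
    (N_gt0 : (0 < N)%N) (A B : 'I_N -> 'M[R]_n)
    (A_ge0 : forall s, mx_le 0 (A s)) (B_ge0 : forall s, mx_le 0 (B s)) :
  let M1 := [set C : 'M[R]_n | exists s r, C = (A s + B r)^T] in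
  let M2 := [set C : 'M[R]_n | exists s, C = A s + B s] in
  let rho1 := max_selection_radius M1 in
  let rho2 := max_selection_radius M2 in
  (exists (mu lambda : R) (d theta : 'cV[R]_n),
    [/\ 0 < mu /\ 0 < lambda,
        mx_gt0 d /\ mx_gt0 theta,
        forall s r, mx_le ((A s + B r)^T *m d) (mu *: d),
        forall s, mx_le ((A s + B s) *m theta) (lambda *: theta)
      & lambda * mu < 1])
  <-> rho1 * rho2 < 1.
Proof.
move=> M1 M2 rho1 rho2.
pose F1 (p : 'I_N * 'I_N) := (A p.1 + B p.2)^T.
pose F2 (s : 'I_N) := A s + B s.
have M1E : M1 = range F1.
  apply/seteqP; split=> C /= [].
    by move=> s [r ->]; exists (s, r).
  by move=> [s r] _ <-; exists s, r.
have M2E : M2 = range F2.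
  apply/seteqP; split=> C /= [].
    by move=> s ->; exists s.
  by move=> s _ <-; exists s.
have F1_ge0 p : mx_le 0 (F1 p).
  move=> i j; rewrite !mxE.
  have := A_ge0 p.1 j i; have := B_ge0 p.2 j i.
  by rewrite !mxE => a b; apply: addr_ge0.
have F2_ge0 s : mx_le 0 (F2 s).
  move=> i j; rewrite !mxE.
  have := A_ge0 s i j; have := B_ge0 s i j.
  by rewrite !mxE => a b; apply: addr_ge0.
have K1 : (0 < #|{: 'I_N * 'I_N}|)%N.
  by rewrite card_prod card_ord muln_gt0 N_gt0.
have K2 : (0 < #|'I_N|)%N by rewrite card_ord.
have rho1_ge0 : 0 <= rho1 by rewrite /rho1 M1E max_selection_radius_ge0.
have rho2_ge0 : 0 <= rho2 by rewrite /rho2 M2E max_selection_radius_ge0.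
split=> [[mu [lambda [d [theta]]]]|rho_lt1].
  case=> -[mu_gt0 lambda_gt0] [d_gt0 theta_gt0] Fd Ftheta lt1.
  apply: le_lt_trans lt1; rewrite mulrC; apply: ler_pM => //.
    by rewrite /rho2 M2E; apply: max_selection_radius_le theta_gt0 _.
  rewrite /rho1 M1E; apply: max_selection_radius_le d_gt0 _ => // -[s r].
  exact: Fd.
pose P := rho1 + rho2 + 1.
have P_gt0 : 0 < P by rewrite /P; lra.
(* With [e <= 1], raising both radii by [e] raises their product by at most
   [e * P], half of the gap [1 - rho1 * rho2]. *)
pose e := (1 - rho1 * rho2) / (2 * P).
have eP : e * P = (1 - rho1 * rho2) / 2 by rewrite /e; field; rewrite gt_eqF.
have e_gt0 : 0 < e by rewrite divr_gt0 ?subr_gt0 ?mulr_gt0.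
have e_le1 : e <= 1.
  rewrite ler_pdivrMr ?mulr_gt0 // mul1r.
  by have := mulr_ge0 rho1_ge0 rho2_ge0; rewrite /P; lra.
have [|d d_gt0 Fd] := @common_subinvariant R n _ F1 (rho1 + e) n_gt0 K1 F1_ge0.
  by rewrite -M1E ltrDl.
have [|theta theta_gt0 Ftheta] :=
  @common_subinvariant R n _ F2 (rho2 + e) n_gt0 K2 F2_ge0.
  by rewrite -M2E ltrDl.
exists (rho1 + e), (rho2 + e), d, theta; split=> //.
- by split; apply: ltr_wpDl.
- by move=> s r; exact: (Fd (s, r)).
- have ee : e * e <= e by rewrite -[leRHS]mulr1 ler_wpM2l // ltW.
  by move: eP; rewrite /P; nra.
Qed.
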